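(* For every $p\in\left(0,\frac{3-\sqrt{5}}{2}\right)$, with $q=1-p$, the optimal configuration $N_{opt}^{(D)}=N_{opt}^{(D)}(p)$ of the modified Dorfman group testing scheme, i.e. a positive integer minimizing $N\mapsto t^{(D)}(N,p)$ over the positive integers, where $$t^{(D)}(N,p)=1-q^N+\frac{1-pq^{N-1}}{N},$$ satisfies $$N_{opt}^{(D)}\in\left\{\lfloor\sqrt{p^{-1}}\rfloor,\ \lfloor\sqrt{p^{-1}}\rfloor+1\right\}.$$
   Context: $\lfloor x\rfloor$ denotes the integer part of a real number $x$. Setting: $N$ objects are drawn at random (independently), each being bad with probability $p\in(0,1)$ (the prevalence) and good with probability $q=1-p$. A group testing scheme identifies the bad objects by testing pooled samples; a pool tests positive exactly when it contains at least one bad object. If $T=T(N,p)$ is the total random number of tests used by the scheme on a batch of $N$ objects, then $t(N,p)=\mathrm{E}\,T/N$ is the average number of tests per object. The optimal configuration $N_{opt}$ of the scheme is a value of the positive integer $N$ minimizing $N\mapsto t(N,p)$ for the given $p$. Modified Dorfman scheme (D): the $N$ samples are pooled and tested; if the pool is negative, nothing more is done; if it is positive, the objects are tested individually one after another, except that the last object is not tested when the first $N-1$ objects all tested negative (it is then known to be bad). For $N\ge 2$ one has $\mathrm{P}(T=1)=q^N$, $\mathrm{P}(T=N)=pq^{N-1}$, $\mathrm{P}(T=N+1)=1-q^N-pq^{N-1}$, so the average number of tests per object is given by the formula for $t^{(D)}(N,p)$ in the claim; for $N=1$ (individual testing) the formula gives $t^{(D)}(1,p)=1$. *)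

(* Defs.v *)
From Stdlib Require Import Reals.
Open Scope R_scope.

Definition t_D (N : nat) (p : R) : R :=
  let q := 1 - p in
  1 - q ^ N + (1 - p * q ^ (N - 1)) / INR N.

(* The minimizer need not be unique, so the optimal configuration is a
   predicate on [N] rather than a function of [p]. *)
Definition optimal_configuration (t : nat -> R -> R) (p : R) (N : nat) : Prop :=
  (1 <= N)%nat /\ forall M : nat, (1 <= M)%nat -> t N p <= t M p.

(* Main.v *)
Require Import Defs.
From Stdlib Require Import Reals Lra Lia ZArith.
Open Scope R_scope.

(** Write [q = 1 - p] and [m] for the integer part of [1 / sqrt p], so that
    [p m^2 <= 1 < p (m + 1)^2].  Clearing denominators in a forward difference
    gives

      [N (N + 1) (t_D (N + 1) - t_D N) = g N - 1],
      with [g N = p q^(N-1) (q N^2 + N + 1)],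

    so the question is where [g] lies above or below [1].

    Below [m] the cost strictly decreases: if [p (N + 1)^2 <= 1] then
    [g N <= p (N^2 + N + 1) < p (N + 1)^2 <= 1] ([t_D_decreasing]).

    At [N = m + 1] one has [g N > 1] ([scaled_step_peak]): Bernoulli's
    inequality reduces this to a polynomial inequality whose only delicate case
    is [m = 1], where it is the condition [1 - 3 p + p^2 > 0], that is,
    [p < (3 - sqrt 5) / 2].

    Beyond [m + 1] the cost cannot be shown to increase forever, because [t_D]
    eventually decreases to its limit [1].  But [g] increases as long as
    [p N <= q], so [t_D] increases at least that far; and when [p N > q], a
    step at which [t_D] fails to increase can only lead to a value at least
    [1] ([one_le_t_D_of_descent]).  Such a value is not optimal,
    because the same condition on [p] says [t_D 2 < t_D 1 = 1].

    Hence every pool size other than [m] and [m + 1] is strictly beaten by one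
    of these two ([t_D_beaten]), which yields both existence and location of
    the minimizers. *)

(** The quantity [g] of the introduction at pool size [N = k + 1]; the shift
    avoids the truncated subtraction [N - 1]. *)
Definition scaled_step (p : R) (k : nat) : R :=
  p * (1 - p) ^ k * ((1 - p) * (INR k + 1) ^ 2 + INR k + 2).

Lemma t_D_S (p : R) (k : nat) :
  t_D (S k) p =
  1 - (1 - p) * (1 - p) ^ k + (1 - p * (1 - p) ^ k) / (INR k + 1).
Proof.
  unfold t_D. replace (S k - 1)%nat with k by lia.
  now rewrite S_INR.
Qed.

Lemma t_D_step (p : R) (k : nat) :
  t_D (S (S k)) p - t_D (S k) p =
  (scaled_step p k - 1) / ((INR k + 1) * (INR k + 2)).
Proof.
  rewrite !t_D_S, S_INR. unfold scaled_step. simpl pow.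
  pose proof (pos_INR k). field. lra.
Qed.

Lemma t_D_step_up (p : R) (k : nat) :
  1 < scaled_step p k -> t_D (S k) p < t_D (S (S k)) p.
Proof.
  intros H. pose proof (t_D_step p k) as E. pose proof (pos_INR k).
  assert (0 < (scaled_step p k - 1) / ((INR k + 1) * (INR k + 2)))
    by (apply Rdiv_lt_0_compat; nra).
  lra.
Qed.

Lemma t_D_step_down (p : R) (k : nat) :
  scaled_step p k < 1 -> t_D (S (S k)) p < t_D (S k) p.
Proof.
  intros H. pose proof (t_D_step p k) as E. pose proof (pos_INR k).
  assert (0 < (1 - scaled_step p k) / ((INR k + 1) * (INR k + 2)))
    by (apply Rdiv_lt_0_compat; nra).
  unfold Rdiv in *. lra.
Qed.

Lemma t_D_1 (p : R) : t_D 1 p = 1.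
Proof. rewrite t_D_S. simpl. field. Qed.

(** * Powers of [1 - p] *)

Lemma pow_compl_bounds (p : R) (k : nat) :
  0 < p < 1 -> 0 < (1 - p) ^ k <= 1.
Proof.
  intros Hp. induction k as [|k IH]; simpl; nra.
Qed.

Lemma Bernoulli_compl (p : R) (k : nat) :
  0 < p < 1 -> 1 - INR k * p <= (1 - p) ^ k.
Proof.
  intros Hp. induction k as [|k IH]; [simpl; lra|].
  rewrite S_INR. simpl pow. pose proof (pos_INR k).
  assert (0 <= INR k * p) by nra. nra.
Qed.

(** * Small pools *)

Lemma scaled_step_small (p : R) (k : nat) :
  0 < p < 1 -> p * (INR k + 2) ^ 2 <= 1 -> scaled_step p k < 1.
Proof.
  intros Hp Hk. unfold scaled_step.
  pose proof (pow_compl_bounds p k Hp) as Hq. pose proof (pos_INR k) as Hx.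
  set (a := (1 - p) ^ k) in *. set (x := INR k) in *.
  assert (0 <= (1 - p) * (x + 1) ^ 2 + x + 2) by nra.
  assert (p * ((1 - p) * (x + 1) ^ 2 + x + 2) < 1).
  { assert ((1 - p) * (x + 1) ^ 2 + x + 2 < (x + 2) ^ 2) by nra. nra. }
  assert (0 <= p * ((1 - p) * (x + 1) ^ 2 + x + 2)) by nra.
  nra.
Qed.

Lemma t_D_decreasing (p : R) (m M : nat) :
  0 < p < 1 -> p * INR m ^ 2 <= 1 -> (1 <= M < m)%nat -> t_D m p < t_D M p.
Proof.
  intros Hp. induction m as [|m IH]; intros Hm HM; [lia|].
  destruct m as [|k]; [lia|].
  rewrite !S_INR in Hm. pose proof (pos_INR k) as Hx.
  assert (Hd : t_D (S (S k)) p < t_D (S k) p).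
  { apply t_D_step_down, scaled_step_small; [exact Hp|].
    replace (INR k + 2) with (INR k + 1 + 1) by ring. exact Hm. }
  destruct (Nat.eq_dec M (S k)) as [->|Hne]; [exact Hd|].
  apply Rlt_trans with (1 := Hd), IH; [|lia].
  rewrite S_INR. nra.
Qed.

(** * Large pools *)

(** With [x = m], [n = x + 1] and [e = p n^2 - 1 > 0], Bernoulli's inequality
    bounds [g n - 1] below by [n p^2 + e ((1 - p) (1 - x p) - p)].  The last
    bracket is [1 - 3 p + p^2] when [x = 1]; when [x >= 2], both [2 p] and
    [x p] are at most [1/2] because [p x^2 <= 1]. *)
Lemma scaled_step_peak (p : R) (m : nat) :
  0 < p < 1 -> 0 < 1 - 3 * p + p ^ 2 -> (1 <= m)%nat ->
  p * INR m ^ 2 <= 1 < p * (INR m + 1) ^ 2 -> 1 < scaled_step p m.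
Proof.
  intros Hp Hp3 Hm [Hlo Hhi]. unfold scaled_step.
  pose proof (Bernoulli_compl p m Hp) as HB.
  assert (Hx : INR m = 1 \/ 2 <= INR m).
  { destruct (Nat.eq_dec m 1) as [->|Hne]; [left; reflexivity|right].
    change 2 with (INR 2). apply le_INR. lia. }
  set (a := (1 - p) ^ m) in *. set (x := INR m) in *.
  assert (Hbr : 0 < (1 - p) * (1 - x * p) - p).
  { destruct Hx as [->|Hx]; [nra|].
    assert (x * p <= 1 / 2) by nra.
    assert (2 * p <= 1 / 2) by nra.
    assert (0 < x * p * p) by (repeat apply Rmult_lt_0_compat; lra). nra. }
  assert (0 < x) by (destruct Hx; lra).
  assert (0 < (p * (x + 1) ^ 2 - 1) * ((1 - p) * (1 - x * p) - p))
    by (apply Rmult_lt_0_compat; lra).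
  assert (1 < (1 - x * p) * (p * ((1 - p) * (x + 1) ^ 2 + x + 2))).
  { replace ((1 - x * p) * (p * ((1 - p) * (x + 1) ^ 2 + x + 2)))
      with (1 + (x + 1) * p ^ 2
            + (p * (x + 1) ^ 2 - 1) * ((1 - p) * (1 - x * p) - p)) by ring.
    nra. }
  assert (0 < p * ((1 - p) * (x + 1) ^ 2 + x + 2)).
  { apply Rmult_lt_0_compat; [lra|].
    assert (0 < (1 - p) * (x + 1) ^ 2) by nra. lra. }
  nra.
Qed.

(** From pool size [N = k + 1] to [N + 1], the inequality is
    [p (q N^2 + N + 1) <= q (2 q N + q + 1)]; inserting [p N <= q] on the left
    leaves [p <= q^2 (N + 1)], which already follows from [p <= 2 q^2]. *)
Lemma scaled_step_increasing (p : R) (k : nat) :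
  0 < p < 1 -> p <= 2 * (1 - p) ^ 2 -> p * (INR k + 1) <= 1 - p ->
  scaled_step p k <= scaled_step p (S k).
Proof.
  intros Hp Hp2 Hk. unfold scaled_step. rewrite S_INR. simpl ((1 - p) ^ S k).
  pose proof (pow_compl_bounds p k Hp) as Hq. pose proof (pos_INR k) as Hx.
  set (a := (1 - p) ^ k) in *. set (x := INR k) in *.
  assert (H : (1 - p) * (x + 1) ^ 2 + x + 2 <=
              (1 - p) * ((1 - p) * (x + 1 + 1) ^ 2 + (x + 1) + 2)).
  { assert (p * (x + 1) * ((1 - p) * (x + 1)) <= (1 - p) * ((1 - p) * (x + 1)))
      by (apply Rmult_le_compat_r; nra).
    assert (0 <= x * (1 - p) ^ 2) by nra.
    nra. }
  replace (p * ((1 - p) * a) * ((1 - p) * (x + 1 + 1) ^ 2 + (x + 1) + 2))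
    with (p * a * ((1 - p) * ((1 - p) * (x + 1 + 1) ^ 2 + (x + 1) + 2))) by ring.
  apply Rmult_le_compat_l; [nra|exact H].
Qed.

(** For [N = k + 1], [t_D (N + 1) >= 1] amounts to
    [q^N (p + (N + 1) q) <= 1], and a step that does not increase the cost
    bounds [q^(N-1)] by [1 / (p (q N^2 + N + 1))].  So it is enough that
    [q (1 + N q) <= p (q N^2 + N + 1)], which holds term by term when
    [p N > q]: [q^2 N <= p q N^2] and [q <= p N + p]. *)
Lemma one_le_t_D_of_descent (p : R) (k : nat) :
  0 < p < 1 -> 1 - p < p * (INR k + 1) ->
  scaled_step p k <= 1 -> 1 <= t_D (S (S k)) p.
Proof.
  intros Hp Hk Hg. rewrite t_D_S, S_INR. unfold scaled_step in Hg.
  simpl ((1 - p) ^ S k).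
  pose proof (pow_compl_bounds p k Hp) as Hq. pose proof (pos_INR k) as Hx.
  set (a := (1 - p) ^ k) in *. set (x := INR k) in *.
  assert (H : (1 - p) * (1 + (x + 1) * (1 - p)) <=
              p * ((1 - p) * (x + 1) ^ 2 + x + 2)).
  { assert ((1 - p) * ((1 - p) * (x + 1)) <= p * (x + 1) * ((1 - p) * (x + 1)))
      by (apply Rmult_le_compat_r; nra).
    nra. }
  assert (Ha : a * ((1 - p) * (1 + (x + 1) * (1 - p))) <=
               a * (p * ((1 - p) * (x + 1) ^ 2 + x + 2)))
    by (apply Rmult_le_compat_l; lra).
  assert (E : (1 - p) * ((1 - p) * a) * (x + 1 + 1) <= 1 - p * ((1 - p) * a))
    by nra.
  apply (Rmult_le_reg_r (x + 1 + 1)); [lra|].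
  replace ((1 - (1 - p) * ((1 - p) * a)
            + (1 - p * ((1 - p) * a)) / (x + 1 + 1)) * (x + 1 + 1))
    with (x + 1 + 1 - (1 - p) * ((1 - p) * a) * (x + 1 + 1)
          + (1 - p * ((1 - p) * a))) by (field; lra).
  lra.
Qed.

Lemma scaled_step_large (p : R) (m k : nat) :
  0 < p < 1 -> p <= 2 * (1 - p) ^ 2 -> 1 < scaled_step p m -> (m <= k)%nat ->
  1 < scaled_step p k \/ 1 - p < p * (INR k + 1).
Proof.
  intros Hp Hp2 Hm Hk. induction Hk as [|k Hk IH]; [now left|].
  destruct (Rlt_le_dec (1 - p) (p * (INR (S k) + 1))) as [H|H]; [now right|left].
  rewrite S_INR in H.
  destruct IH as [IH|IH]; [|nra].
  apply Rlt_le_trans with (1 := IH), scaled_step_increasing; nra.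
Qed.

Lemma t_D_large (p : R) (m k : nat) :
  0 < p < 1 -> p <= 2 * (1 - p) ^ 2 -> 1 < scaled_step p m ->
  (m < k)%nat ->
  t_D (S m) p < t_D (S k) p \/ 1 <= t_D (S k) p.
Proof.
  intros Hp Hp2 Hg Hk.
  assert (Hstep : forall j, (m <= j)%nat ->
    t_D (S j) p < t_D (S (S j)) p \/ 1 <= t_D (S (S j)) p).
  { intros j Hj.
    destruct (Rlt_le_dec 1 (scaled_step p j)) as [H|H];
      [left; now apply t_D_step_up|right].
    destruct (scaled_step_large p m j Hp Hp2 Hg Hj) as [H'|H']; [lra|].
    now apply one_le_t_D_of_descent. }
  induction Hk as [|k Hk IH]; [apply Hstep; lia|].
  destruct (Hstep k ltac:(lia)); destruct IH; lra.
Qed.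

(** * Location of the minimizers *)

Lemma t_D_beaten (p : R) (m M : nat) :
  0 < p < 1 -> 0 < 1 - 3 * p + p ^ 2 -> (1 <= m)%nat ->
  p * INR m ^ 2 <= 1 < p * (INR m + 1) ^ 2 ->
  (1 <= M)%nat -> M <> m -> M <> S m ->
  t_D m p < t_D M p \/ t_D (S m) p < t_D M p.
Proof.
  intros Hp Hp3 Hm Hpm HM Hne1 Hne2.
  destruct (Nat.lt_ge_cases M m) as [Hlt|Hge].
  { left. now apply t_D_decreasing; [|apply Hpm|]. }
  destruct M as [|k]; [lia|].
  assert (Hmin : t_D m p < 1 \/ t_D (S m) p < 1).
  { rewrite <- (t_D_1 p). destruct (Nat.eq_dec m 1) as [->|Hne].
    - right. apply t_D_step_down. unfold scaled_step. simpl. nra.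
    - left. apply t_D_decreasing; [exact Hp|apply Hpm|lia]. }
  pose proof (scaled_step_peak p m Hp Hp3 Hm Hpm) as Hg.
  destruct (t_D_large p m k Hp ltac:(nra) Hg ltac:(lia)); lra.
Qed.

Lemma quadratic_pos_of_lt_golden (p : R) :
  p < (3 - sqrt 5) / 2 -> 0 < 1 - 3 * p + p ^ 2.
Proof.
  intros H. pose proof (sqrt_sqrt 5 ltac:(lra)). pose proof (sqrt_pos 5).
  nra.
Qed.

Lemma Int_part_inv_sqrt (p : R) :
  0 < p < 1 ->
  exists m : nat, Int_part (sqrt (/ p)) = Z.of_nat m /\ (1 <= m)%nat /\
    p * INR m ^ 2 <= 1 < p * (INR m + 1) ^ 2.
Proof.
  intros Hp. set (s := sqrt (/ p)).
  assert (Hip : 1 < / p) by (rewrite <- Rinv_1; apply Rinv_lt_contravar; lra).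
  assert (Hs : p * (s * s) = 1)
    by (unfold s; rewrite sqrt_sqrt by lra; field; lra).
  assert (Hs1 : 1 < s)
    by (unfold s; rewrite <- sqrt_1; apply sqrt_lt_1; lra).
  destruct (base_Int_part s) as [Hle Hgt].
  assert (Hpos : (0 < Int_part s)%Z) by (apply lt_IZR; lra).
  exists (Z.to_nat (Int_part s)).
  assert (E : INR (Z.to_nat (Int_part s)) = IZR (Int_part s))
    by (rewrite INR_IZR_INZ, Z2Nat.id by lia; reflexivity).
  rewrite E. repeat split; [lia|lia| |]; apply IZR_lt in Hpos;
    rewrite <- Hs; set (z := IZR (Int_part s)) in *.
  - apply Rmult_le_compat_l; nra.
  - apply Rmult_lt_compat_l; nra.
Qed.

Theorem proposition2p2 (p : R) (hp0 : 0 < p) (hp1 : p < (3 - sqrt 5) / 2) :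
  (exists N : nat, optimal_configuration t_D p N) /\
  (forall N : nat, optimal_configuration t_D p N ->
     Z.of_nat N = Int_part (sqrt (/ p)) \/
     Z.of_nat N = (Int_part (sqrt (/ p)) + 1)%Z).
Proof.
  pose proof (quadratic_pos_of_lt_golden p hp1) as Hp3.
  assert (Hp : 0 < p < 1) by (pose proof (sqrt_lt_1 1 5); rewrite sqrt_1 in *; lra).
  destruct (Int_part_inv_sqrt p Hp) as (m & -> & Hm & Hpm).
  pose proof (fun M => t_D_beaten p m M Hp Hp3 Hm Hpm) as Hbeat.
  split.
  - destruct (Rle_lt_dec (t_D m p) (t_D (S m) p)) as [Hle|Hlt];
      [exists m|exists (S m)]; (split; [lia|]); intros M HM;
      (destruct (Nat.eq_dec M m) as [->|H1]; [lra|]);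
      (destruct (Nat.eq_dec M (S m)) as [->|H2]; [lra|]);
      destruct (Hbeat M HM H1 H2); lra.
  - intros N [HN Hopt].
    destruct (Nat.eq_dec N m) as [->|H1]; [now left|].
    destruct (Nat.eq_dec N (S m)) as [->|H2]; [right; lia|].
    pose proof (Hopt m Hm). pose proof (Hopt (S m) ltac:(lia)).
    destruct (Hbeat N HN H1 H2); lra.
Qed.
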